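(* There is a locally compact subset $X$ of the plane $\mathbb{R}^2$ such that $E_X^C \sim_B E_1$.
   Context: A continuum is a nonempty compact connected metrizable space (single points are continua). The continuum-connection relation $E_X^C$ on $X$ is $x\,E_X^C\,y$ iff there is a continuum in $X$ containing $x$ and $y$. The relation $E_1$ on $2^{\mathbb{N}\times\mathbb{N}}$ is defined by $xE_1y \iff \exists m\ \forall n\ge m\ \forall k\ x(n,k)=y(n,k)$. For equivalence relations $E,F$ on standard Borel spaces $X,Y$, $E\leq_B F$ means that there is a Borel map $f:X\to Y$ with $xEy\iff f(x)Ff(y)$ for all $x,y\in X$, and $E\sim_B F$ means $E\leq_B F$ and $F\leq_B E$. *)

(* Defs.v *)
From mathcomp Require Import all_boot all_order all_algebra.
From mathcomp Require Import all_classical all_reals all_analysis.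

Set Implicit Arguments.
Unset Strict Implicit.
Unset Printing Implicit Defensive.

Import Order.TTheory GRing.Theory Num.Theory.
Import numFieldNormedType.Exports.

Local Open Scope classical_set_scope.
Local Open Scope ring_scope.

Definition homeomorphic (T U : topologicalType) : Prop :=
  exists (f : T -> U) (g : U -> T),
    [/\ continuous f, continuous g, cancel f g & cancel g f].

Definition metrizable (R : realType) (T : topologicalType) : Prop :=
  exists M : metricType R, homeomorphic T M.

Definition continuum (R : realType) (T : topologicalType) : Prop :=
  [/\ [set: T] !=set0, compact [set: T], connected [set: T] & metrizable R T].

(* [set_type C] carries the subspace topology. *)
Definition continuum_connected (R : realType) (T : topologicalType) (x y : T) :
    Prop :=
  exists C : set T, [/\ continuum R (set_type C), C x & C y].

Definition borel (T : topologicalType) : set (set T) := <<s @open T >>.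

(* The library's [measurable_fun] is not used because its domain has to be a
   pointed type, whereas a subtype [set_type X] may be empty. *)
Definition borel_fun (T U : topologicalType) (f : T -> U) : Prop :=
  forall B : set U, borel B -> borel (f @^-1` B).

(* The standard Borel structure is the one generated by the topology. *)
Definition borel_reducible (T U : topologicalType)
    (E : T -> T -> Prop) (F : U -> U -> Prop) : Prop :=
  exists2 f : T -> U, borel_fun f & forall x y, E x y <-> F (f x) (f y).

Definition borel_bireducible (T U : topologicalType)
    (E : T -> T -> Prop) (F : U -> U -> Prop) : Prop :=
  borel_reducible E F /\ borel_reducible F E.

(* [{ptws _ -> _}] carries the product topology, here of the discrete [bool]. *)
Definition E1 (x y : {ptws (nat * nat)%type -> bool}) : Prop :=
  exists m : nat, forall n : nat, (m <= n)%N -> forall k : nat,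
    x (n, k) = y (n, k).

(* Main.v *)
Require Import Defs.
From HB Require Import structures.
From mathcomp Require Import all_boot all_order all_algebra.
From mathcomp Require Import all_classical all_reals all_analysis.
From mathcomp Require Import zify ring lra.
Import Order.TTheory GRing.Theory Num.Theory.
Import numFieldNormedType.Exports.
Local Open Scope classical_set_scope.
Local Open Scope ring_scope.

Set Implicit Arguments.
Unset Strict Implicit.
Unset Printing Implicit Defensive.

(** The space is a planar attractor of a non-autonomous Lozi-type system.  Let
    [w_k] be walks on the half-line of naturals, [H_0 = id] and
    [H_(k+1) = H_k o w_k].  Extending [w_k] to a 1-Lipschitz map [g_k] of the
    line, a point [(s_0, s_1)] of the plane determines a sequence by
    [s_k = g_k s_(k+1) + c_k s_(k+2)], and [X] is the set of points with all
    [s_k >= 0].  It is closed, since every [s_k] is a continuous function on the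
    plane, and it is a perturbation of the inverse limit of the [w_k].  When the
    [c_k] decay fast enough, [s_0] stays comparable to [H_k] read at [s_k], so a
    continuum of [X], on which [s_0] is bounded, cannot jump over an integer [i]
    with [H_k i] large; conversely, an intersection of nested rectangles joins
    two points which no such integer separates.  Hence continuum connection
    means: for some [m], no [i] with [H_k i > m] lies between the [k]-th
    coordinates, for any [k].  Recording the position relative to all those
    [i] gives a reduction to [E1].

    For the converse reduction, a maximal interval on which [H_k <= m] is called
    an [m]-box.  The walk [w_k] runs through each [m]-box, with [m] depending on
    [k], three times (forward, backward, forward), turning at depth [m + 1].
    A point of an [m]-box may be lifted to its first or its second copy
    according to a bit; two lifts stay in the same [n]-box iff the original
    points are in the same [n]-box and either [n > m] or the bits agree.  When
    each bit [x (n, j)] is used at some stage of level [n], the points coded by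
    [x] and [y] are in the same [m]-box at all stages iff [x] and [y] agree
    from row [m] on. *)

(** * Walks and boxes *)

Section Walks.
Local Open Scope nat_scope.

Definition is_walk (w : nat -> nat) :=
  w 0 = 0 /\ forall t, w t.+1 = (w t).+1 \/ w t = (w t.+1).+1.

Definition proper_walk (w : nat -> nat) := exists c, forall t, t <= w t + c.

Definition same_box (H : nat -> nat) (m p q : nat) :=
  forall i, minn p q <= i <= maxn p q -> H i <= m.

Lemma same_boxC H m p q : same_box H m p q -> same_box H m q p.
Proof. by move=> h i; rewrite minnC maxnC; apply: h. Qed.

Lemma same_box_trans H m p q r :
  same_box H m p q -> same_box H m q r -> same_box H m p r.
Proof.
move=> h1 h2 i hi.
have [|] : (minn p q <= i <= maxn p q) \/ (minn q r <= i <= maxn q r) by lia.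
  exact: h1.
exact: h2.
Qed.

Lemma same_boxl H m p q : same_box H m p q -> H p <= m.
Proof. by move=> h; apply: h; lia. Qed.

Lemma same_boxr H m p q : same_box H m p q -> H q <= m.
Proof. by move=> h; apply: h; lia. Qed.

Lemma same_box_refl H m p : H p <= m -> same_box H m p p.
Proof. by move=> h i hi; have -> : i = p by lia. Qed.

Lemma same_box_le H m n p q : m <= n -> same_box H m p q -> same_box H n p q.
Proof. by move=> mn h i /h hi; lia. Qed.

(** A discrete intermediate value theorem: unit steps skip no integer. *)
Lemma walk_ivt w a b i : is_walk w ->
  minn (w a) (w b) <= i <= maxn (w a) (w b) ->
  exists2 t, minn a b <= t <= maxn a b & w t = i.
Proof.
move=> [_ Ww]; wlog ab : a b / a <= b.
  move=> h; case/orP: (leq_total a b) => [ab|ab hi]; first exact: h.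
  by have [|t ht <-] := h b a ab; [lia | exists t => //; lia].
rewrite (minn_idPl ab) (maxn_idPr ab).
elim: b ab => [|b IH] ab hi.
  have a0 : a = 0 by lia.
  by exists a; [lia | rewrite a0 in hi *; lia].
have [ab'|ab'] : a <= b \/ b < a by lia.
  2: have E : a = b.+1 by lia.
  2: by exists a; [lia | rewrite -E in hi; lia].
have [/(IH ab')[t ht <-]|hi'] := boolP (minn (w a) (w b) <= i <= maxn (w a) (w b)).
  by exists t => //; lia.
by exists b.+1; [lia|have := Ww b; lia].
Qed.

Lemma same_box_walk H w m a b : is_walk w ->
  same_box (H \o w) m a b -> same_box H m (w a) (w b).
Proof. by move=> Ww h i /(walk_ivt Ww)[t /h /= + <-]. Qed.

(** * Tripling the boxes of a walk *)

Section Tripling.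
Variables (H : nat -> nat) (m : nat).
Hypotheses (HW : is_walk H) (Hp : proper_walk H).

(* A state is a position with a phase: 0 for the first forward passage (and for
   the motion between boxes), 1 for the backward one, 2 for the second forward
   one.  The box starting at 0 is bounded on the right only, so its backward
   passage ends at 0 itself and its last two copies may be joined; only the
   first two copies of a box are used for the coding. *)
Definition triple_step (s : nat * nat) : nat * nat :=
  match s.2 with
  | 0 => if [&& 0 < s.1, m < H s.1 & H s.1.-1 <= m] then (s.1.-1, 1)
         else (s.1.+1, 0)
  | 1 => if (0 < s.1) && (H s.1 <= m) then (s.1.-1, 1) else (s.1.+1, 2)
  | _ => if H s.1 <= m then (s.1.+1, 2) else (s.1.+1, 0)
  end.

Definition triple_state t := iter t triple_step (0, 0).
Definition triple_walk t := (triple_state t).1.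

Local Notation st := triple_state.
Local Notation w := triple_walk.

Lemma triple_stateS t : st t.+1 = triple_step (st t). Proof. by []. Qed.

Lemma triple_walkP : is_walk w.
Proof.
split=> // t; rewrite /w triple_stateS /triple_step.
case: (st t) => i [|[|f]] /=; case: ifP => /=; lia.
Qed.

Lemma triple_run0 t i j : st t = (i, 0) -> i <= j ->
  (forall k, i <= k < j -> H k <= m) -> st (t + (j - i)) = (j, 0).
Proof.
move=> sti; elim: j => [|j IH] ij hB.
  have i0 : i = 0 by lia.
  by rewrite i0 in sti *; rewrite addn0.
case: (ltngtP i j.+1) ij => // [ij|ij] _; last by subst; rewrite subnn addn0.
have e : t + (j.+1 - i) = (t + (j - i)).+1 by lia.
rewrite e triple_stateS IH //; last by move=> k hk; apply: hB; lia.
rewrite /triple_step /=; have := hB j; case: ifP => //; lia.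
Qed.

Lemma triple_run1 t i j : st t = (i, 1) -> j <= i ->
  (forall k, j < k <= i -> H k <= m) -> st (t + (i - j)) = (j, 1).
Proof.
move=> sti ji hB.
suff h d : d <= i - j -> st (t + d) = (i - d, 1).
  by rewrite h //; congr pair; lia.
elim: d => [|d IH] hd; first by rewrite addn0 subn0.
rewrite addnS triple_stateS IH; last by lia.
rewrite /triple_step /=; have := hB (i - d); case: ifP; last lia.
by move=> _ _; congr pair; lia.
Qed.

Lemma triple_run2 t i j : st t = (i, 2) -> i <= j ->
  (forall k, i <= k < j -> H k <= m) -> st (t + (j - i)) = (j, 2).
Proof.
move=> sti; elim: j => [|j IH] ij hB.
  have i0 : i = 0 by lia.
  by rewrite i0 in sti *; rewrite addn0.
case: (ltngtP i j.+1) ij => // [ij|ij] _; last by subst; rewrite subnn addn0.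
have e : t + (j.+1 - i) = (t + (j - i)).+1 by lia.
rewrite e triple_stateS IH //; last by move=> k hk; apply: hB; lia.
rewrite /triple_step /=; have := hB j; case: ifP => //; lia.
Qed.

(** When the walk turns back at [i], it runs through the box ending at [i.-1] backward and forward
    again, never above [i], and then leaves [i] to the right in phase 0. *)
Lemma triple_reach i : exists2 t : nat, st t = (i, 0) & forall t', t' < t -> w t' < i.
Proof.
elim: i => [|i [t sti tlt]]; first by exists 0.
have [/and3P[i0 hi hi1]|hB] := boolP [&& 0 < i, m < H i & H i.-1 <= m]; last first.
  exists t.+1; first by rewrite triple_stateS sti /triple_step (negbTE hB).
  move=> t'; rewrite ltnS leq_eqVlt => /predU1P[->|/tlt]; last by lia.
  by rewrite /w sti.
(* [a] is the left end of the box that ends at [i.-1]. *)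
have [a [ai aB aN]] : exists a, [/\ a < i, forall k, a <= k < i -> H k <= m &
    a = 0 \/ 0 < a /\ m < H a.-1].
  have : exists a, [&& a < i & all (fun k => H k <= m) (iota a (i - a))].
    exists i.-1; have -> : i - i.-1 = 1 by lia.
    by rewrite /= hi1 andbT; lia.
  move=> /ex_minnP[a /andP[ai /allP aB] amin]; exists a; split=> //.
    by move=> k hk; apply: aB; rewrite mem_iota; lia.
  case: a => [|a] in ai aB amin *; [by left|right; split=> //=].
  rewrite ltnNge; apply/negP => Ha.
  have := amin a; suff -> : (a < i) && all (fun k => H k <= m) (iota a (i - a)).
    by move=> /(_ isT); rewrite ltnn.
  apply/andP; split; first lia.
  have -> : i - a = (i - a.+1).+1 by lia.
  by rewrite /= Ha /=; apply/allP.
have s1 : st t.+1 = (i.-1, 1).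
  by rewrite triple_stateS sti /triple_step /= i0 hi hi1.
have ra d : d <= i.-1 - a -> st (t.+1 + d) = (i.-1 - d, 1).
  move=> hd; have := @triple_run1 t.+1 i.-1 (i.-1 - d) s1 (leq_subr _ _).
  rewrite subKn; last lia.
  by apply => k hk; apply: aB; lia.
set t1 := t.+1 + (i.-1 - a).
have st1 : st t1 = (a, 1) by rewrite ra //; congr pair; lia.
have Ha : H a <= m by apply: aB; lia.
(* The left turn takes place at [a.-1], or at 0 if the box starts there; so phase 2 begins at
   [b = a] or at [b = 1]. *)
have [t2 [b [t12 st2 hb bB]]] : exists t2 b, [/\ t1 < t2, st t2 = (b, 2),
     (a <= b <= i) /\ (forall k, b <= k < i -> H k <= m) &
     forall t', t1 <= t' <= t2 -> w t' <= i].
  case: aN => [a0|[a0 Na]].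
    exists t1.+1, a.+1; split => //.
    - by rewrite triple_stateS st1 /triple_step /= a0.
    - by split; [lia|move=> k hk; apply: aB; lia].
    - move=> t' ht'; have [->|->] : t' = t1 \/ t' = t1.+1 by lia.
        by rewrite /w st1 /=; lia.
      by rewrite /w triple_stateS st1 /triple_step /= a0 /=; lia.
  have st2 : st t1.+1 = (a.-1, 1).
    by rewrite triple_stateS st1 /triple_step /= a0 Ha.
  have st3 : st t1.+2 = (a, 2).
    rewrite triple_stateS st2 /triple_step /=; case: ifP; first lia.
    by move=> _; rewrite prednK.
  exists t1.+2, a; split=> //; first by split; [lia|].
  move=> t' ht'; have [->|[->|->]] : t' = t1 \/ t' = t1.+1 \/ t' = t1.+2 by lia.
  - by rewrite /w st1 /=; lia.
  - by rewrite /w st2 /=; lia.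
  - by rewrite /w st3 /=; lia.
have rb d : d <= i - b -> st (t2 + d) = (b + d, 2).
  move=> hd; have := @triple_run2 t2 b (b + d) st2 (leq_addr _ _).
  by rewrite addKn; apply => k hk; apply hb.2; lia.
exists (t2 + (i - b)).+1.
  rewrite triple_stateS rb // /triple_step /= subnKC; last by lia.
  by rewrite leqNgt hi.
move=> t' ht'; rewrite ltnS.
have [/tlt|[->|[h|[h|h]]]] : t' < t \/ t' = t \/ t < t' <= t1 \/
    t1 <= t' <= t2 \/ t2 <= t' by lia.
- lia.
- by rewrite /w sti.
- have -> : t' = t.+1 + (t' - t.+1) by lia.
  by rewrite /w ra /=; lia.
- exact: bB.
- have -> : t' = t2 + (t' - t2) by lia.
  by rewrite /w rb /=; lia.
Qed.

(** A step back from [i.+1] to [i] would need depth at most [m] at [i] or at [i.+1]; [H i > m.+1]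
    excludes both. *)
Lemma triple_cut_after t t' i : st t = (i, 0) -> m.+1 < H i -> t < t' -> i < w t'.
Proof.
move=> sti hi tt'.
have Hi1 : m < H i.+1 by have := HW.2 i; lia.
rewrite /w; elim: t' tt' => // t' IH; rewrite ltnS leq_eqVlt => /predU1P[<-|/IH {IH}].
  rewrite triple_stateS sti /triple_step /=; case: ifP => //= /and3P[i0 _ h].
  by have := HW.2 i.-1; rewrite prednK //; lia.
rewrite triple_stateS /triple_step.
case: (st t') => j [|[|f]] /= hj; case: ifP => /=; try lia.
- case/and3P=> j0 h1 h2; have : j.-1 <> i by move=> e; rewrite e in h2; lia.
  by lia.
- case/andP=> j0 h1; have : j <> i.+1 by move=> e; rewrite e in h1; lia.
  by lia.
Qed.

Definition reach_time i := s2val (cid2 (triple_reach i)).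

Lemma reach_time_state i : st (reach_time i) = (i, 0).
Proof. exact: (s2valP (cid2 (triple_reach i))). Qed.

Lemma reach_time_before i t : t < reach_time i -> w t < i.
Proof. exact: (s2valP' (cid2 (triple_reach i))). Qed.

(** A position deeper than [m.+1] is visited only once, at its reach time, which therefore cuts the
    walk into a left and a right part. *)
Lemma triple_cut t1 t2 t : m.+1 < H (w t) -> t1 <= t <= t2 ->
  w t1 <= w t <= w t2.
Proof.
set i0 := w t => hi ht.
have et : t = reach_time i0.
  have [/reach_time_before|/(triple_cut_after (reach_time_state i0) hi)|//] :=
    ltngtP t (reach_time i0); rewrite -/i0; lia.
apply/andP; split.
  have [/reach_time_before|] := ltnP t1 (reach_time i0); first by lia.
  by move=> h; have -> : t1 = t by lia.
have [] := ltnP (reach_time i0) t2.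
  by move/(triple_cut_after (reach_time_state i0) hi); lia.
by move=> h; have -> : t2 = t by lia.
Qed.

Lemma box_end_ex i : exists r, (i <= r) && (m < H r).
Proof.
have [c Hc] := Hp; exists (i + m + c).+1; have := Hc (i + m + c).+1; lia.
Qed.

Definition box_end i := ex_minn (box_end_ex i).

Lemma box_endP i : [/\ i <= box_end i, m < H (box_end i) &
  forall k, i <= k < box_end i -> H k <= m].
Proof.
rewrite /box_end; case: ex_minnP => r /andP[ir hr] rmin; split=> // k hk.
by rewrite leqNgt; apply/negP => hk'; have := rmin k; lia.
Qed.

Lemma box_end_eq p q : p <= q -> (forall k, p <= k <= q -> H k <= m) ->
  box_end p = box_end q.
Proof.
move=> pq hB; have [h1 h2 h3] := box_endP p; have [k1 k2 k3] := box_endP q.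
have h4 : q < box_end p by rewrite ltnNge; apply/negP => h; have := hB (box_end p); lia.
apply/eqP; rewrite eqn_leq; apply/andP; split; rewrite leqNgt; apply/negP => h.
  by have := h3 (box_end q); lia.
by have := k3 (box_end p); lia.
Qed.

(** Bit [false] picks the first forward passage; bit [true] picks the backward one, which starts
    from the end of the box and is back at [i] after [box_end i - i] steps. *)
Definition bit_lift (b : bool) (i : nat) : nat :=
  if b then reach_time (box_end i) + (box_end i - i) else reach_time i.

Lemma lift1_run i d : H i <= m -> d < box_end i - i ->
  st ((reach_time (box_end i)).+1 + d) = ((box_end i).-1 - d, 1).
Proof.
move=> hi hd; have [h1 h2 h3] := box_endP i.
have s0 : st (reach_time (box_end i)).+1 = ((box_end i).-1, 1).
  rewrite triple_stateS reach_time_state /triple_step /=.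
  by rewrite h2 h3 ?andbT /=; [case: ifP => //; lia | lia].
have := @triple_run1 _ (box_end i).-1 ((box_end i).-1 - d) s0 (leq_subr _ _).
rewrite subKn; last by lia.
by apply=> k hk; apply: h3; lia.
Qed.

Lemma lift_state b i : H i <= m -> st (bit_lift b i) = (i, b : nat).
Proof.
rewrite /bit_lift; case: b => hi; last exact: reach_time_state.
have [h1 h2 h3] := box_endP i.
have hlt : i < box_end i.
  by rewrite ltn_neqAle h1 andbT; apply: contraTneq h2 => <-; rewrite -leqNgt.
have -> : reach_time (box_end i) + (box_end i - i) =
  (reach_time (box_end i)).+1 + (box_end i - i).-1 by lia.
by rewrite lift1_run //; [congr pair|]; lia.
Qed.

Lemma walk_lift b i : H i <= m -> w (bit_lift b i) = i.
Proof. by move=> hi; rewrite /w lift_state. Qed.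

(** Two lifts with the same bit lie on one passage of the box, where the walk is monotone. *)
Lemma lift_same_bit b p q t : p <= q -> (forall k, p <= k <= q -> H k <= m) ->
  minn (bit_lift b p) (bit_lift b q) <= t <= maxn (bit_lift b p) (bit_lift b q) ->
  p <= w t <= q.
Proof.
move=> pq hB; rewrite /bit_lift; case: b.
  have eb := box_end_eq pq hB; rewrite -eb => ht.
  have [h1 h2 h3] := box_endP q; rewrite -eb in h1 h2 h3.
  have hq : q < box_end p.
    rewrite ltn_neqAle h1 andbT; apply: contraTneq h2 => <-.
    by rewrite -leqNgt hB // pq leqnn.
  have -> : t = (reach_time (box_end p)).+1 + (t - (reach_time (box_end p)).+1) by lia.
  rewrite /w lift1_run /=; [lia| by apply: hB; lia | lia].
have run k : p <= k <= q -> st (reach_time p + (k - p)) = (k, 0).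
  move=> hk; apply: triple_run0; [exact: reach_time_state|lia|].
  by move=> j hj; apply: hB; lia.
have [h|h] := leqP (reach_time q) (reach_time p + (q - p)); last first.
  have := reach_time_before h; rewrite /w run /=; lia.
have [h'|h'] := leqP (reach_time p) (reach_time q); last first.
  have := reach_time_before h'; rewrite /w reach_time_state /=; lia.
move=> ht; have -> : t = reach_time p + ((p + (t - reach_time p)) - p) by lia.
by rewrite /w run /=; lia.
Qed.

(** While the depth stays at most [m], phase 0 is neither entered nor left. Phases 1 and 2 are not
    distinguished, because the turn at position 0 happens inside a box. *)
Lemma lift_other_bit b p q : H p <= m -> H q <= m ->
  ~ same_box (H \o w) m (bit_lift b p) (bit_lift (~~ b) q).
Proof.
wlog bF : b p q / b = false.
  case: b => h hp hq; last exact: h.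
  by move/same_boxC; apply: (h false).
rewrite {}bF /= => hp hq hs.
suff h t1 t2 : t1 <= t2 -> (forall t, t1 <= t <= t2 -> H (w t) <= m) ->
    ((st t1).2 == 0) = ((st t2).2 == 0).
  case/orP: (leq_total (bit_lift false p) (bit_lift true q)) => hle.
    have := h _ _ hle; rewrite !lift_state //= => /(_ _) E.
    suff : true = false by []. apply: E => t ht; apply: (hs t).
    by rewrite (minn_idPl hle) (maxn_idPr hle).
  have := h _ _ hle; rewrite !lift_state //= => /(_ _) E.
  suff : false = true by []. apply: E => t ht; apply: (hs t).
  by rewrite (minn_idPr hle) (maxn_idPl hle).
elim: t2 => [|t2 IH] h12 hB; first by have -> : t1 = 0 by lia.
have [->//|h12'] := eqVneq t1 t2.+1.
rewrite IH; [|lia|by move=> t ht; apply: hB; lia].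
have := hB t2; rewrite /w triple_stateS /triple_step.
case: (st t2) => j [|[|f]] /= hj; case: ifP => //=; lia.
Qed.

(** If [m < n], a time of depth above [n] between the lifts would be a cut, so its position would
    lie between [p] and [q]. If [n <= m], different bits are separated already at height [m], and
    equal bits give a monotone passage. *)
Lemma lift_same_box n b b' p q : H p <= minn m n -> H q <= minn m n ->
  same_box (H \o w) n (bit_lift b p) (bit_lift b' q) <->
  same_box H n p q /\ (m < n \/ b = b').
Proof.
move=> hp hq; have hp' : H p <= m by lia. have hq' : H q <= m by lia.
split.
  move=> hs; split.
    by have := same_box_walk triple_walkP hs; rewrite !walk_lift.
  have [|nm] := ltnP m n; [by left|right].
  have [//|/eqP bb] := eqVneq b b'.
  have := same_box_le nm hs; have -> : b' = ~~ b by case: b b' bb {hs} => [] [].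
  by move/lift_other_bit => /(_ hp' hq').
move=> [hs hb] t ht /=.
have [//|nH] := leqP (H (w t)) n.
have [mn|nm] := ltnP m n.
  have : minn p q <= w t <= maxn p q; last by move=> /hs; lia.
  have hi : m.+1 < H (w t) by lia.
  case/orP: (leq_total (bit_lift b p) (bit_lift b' q)) => hle.
    rewrite (minn_idPl hle) (maxn_idPr hle) in ht.
    by have := triple_cut hi ht; rewrite !walk_lift //; lia.
  rewrite (minn_idPr hle) (maxn_idPl hle) in ht.
  by have := triple_cut hi ht; rewrite !walk_lift //; lia.
case: hb => [|bb]; first lia.
rewrite -{}bb in ht.
case/orP: (leq_total p q) => pq.
  have := @lift_same_bit b p q t pq; rewrite ht => /(_ _ isT) h.
  have : H (w t) <= n; last by lia.
  apply: (hs _); rewrite (minn_idPl pq) (maxn_idPr pq); apply: h => k hk.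
  by apply: leq_trans nm; apply: hs; lia.
have := @lift_same_bit b q p t pq; rewrite minnC maxnC ht => /(_ _ isT) h.
have : H (w t) <= n; last by lia.
apply: (hs _); rewrite (minn_idPr pq) (maxn_idPl pq); apply: h => k hk.
by apply: leq_trans nm; apply: hs; lia.
Qed.

(** From [M.-1] on the depth exceeds [m], so once [M] is reached the walk never turns again. *)
Lemma triple_walk_proper : proper_walk w.
Proof.
have [c Hc] := Hp; pose M := c + m + 2.
have run d : st (reach_time M + d) = (M + d, 0).
  elim: d => [|d IH]; first by rewrite !addn0 reach_time_state.
  rewrite !addnS triple_stateS IH /triple_step /=.
  by have := Hc (M + d).-1; case: ifP => //; lia.
exists (reach_time M) => t.
have [h|h] := leqP (reach_time M) t; last by lia.
have -> : t = reach_time M + (t - reach_time M) by lia.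
by rewrite /w run /=; lia.
Qed.

End Tripling.

(** * The tower of walks and the addresses of bit arrays *)

Definition bit_index (k : nat) : nat * nat := odflt (0, 0) (unpickle k).

Lemma bit_index_surj ij : exists k, bit_index k = ij.
Proof. by exists (pickle ij); rewrite /bit_index pickleK. Qed.

Definition level (k : nat) := (bit_index k).1.

Fixpoint depth (k : nat) : nat -> nat :=
  if k is k'.+1 then depth k' \o triple_walk (depth k') (level k') else id.

Definition walk (k : nat) := triple_walk (depth k) (level k).

Lemma is_walk_comp H w : is_walk H -> is_walk w -> is_walk (H \o w).
Proof.
move=> [H0 HS] [w0 wS]; split; first by rewrite /= w0.
move=> t /=; have [->|->] := wS t; [exact: HS|].
by have := HS (w t.+1); lia.
Qed.

Lemma proper_walk_comp H w : proper_walk H -> proper_walk w ->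
  proper_walk (H \o w).
Proof.
move=> [c Hc] [d Hd]; exists (c + d) => t /=.
by have := Hd t; have := Hc (w t); lia.
Qed.

Lemma depthP k : is_walk (depth k) /\ proper_walk (depth k).
Proof.
elim: k => [|k [IH1 IH2]] /=.
  by split; [split=> // t; left|exists 0 => t; rewrite addn0].
split; first exact/is_walk_comp/triple_walkP.
exact/proper_walk_comp/triple_walk_proper.
Qed.

Lemma walkP k : is_walk (walk k). Proof. exact: triple_walkP. Qed.

Lemma walk_proper k : proper_walk (walk k).
Proof. by apply: triple_walk_proper; apply depthP. Qed.

Definition walk_defect k := sval (cid (walk_proper k)).

Lemma walk_defectP k t : t <= walk k t + walk_defect k.
Proof. exact: (svalP (cid (walk_proper k))). Qed.

Fixpoint defect (k : nat) : nat :=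
  if k is k'.+1 then defect k' + walk_defect k' else 0.

Lemma defectP k i : i <= depth k i + defect k.
Proof.
elim: k i => [|k IH] i /=; first by rewrite addn0.
by have := IH (walk k i); have := walk_defectP k i; rewrite /walk; lia.
Qed.

Lemma depth_lip k i j : depth k i <= depth k j + ((i - j) + (j - i)).
Proof.
have [[_ HS] _] := depthP k.
have le d a : depth k (a + d) <= depth k a + d /\ depth k a <= depth k (a + d) + d.
  elim: d => [|d]; first by rewrite addn0; lia.
  by rewrite addnS; have := HS (a + d); lia.
case/orP: (leq_total i j) => ij.
  by have := le (j - i) i; rewrite subnKC //; lia.
by have := le (i - j) j; rewrite subnKC //; lia.
Qed.

(** The backward thread through the walks that codes [x]. All its points have depth 0, so they lie
    in boxes of every height and can always be lifted. *)
Fixpoint address (x : nat * nat -> bool) (k : nat) : nat :=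
  if k is k'.+1 then
    @bit_lift (depth k') (level k') (depthP k').2 (x (bit_index k')) (address x k')
  else 0.

Lemma depth_address x k : depth k (address x k) = 0.
Proof.
by elim: k => //= k IH; rewrite walk_lift // IH.
Qed.

Lemma walk_address x k : walk k (address x k.+1) = address x k.
Proof. by rewrite /walk /= walk_lift // depth_address. Qed.

Lemma eq_address x y k : (forall j, j < k -> x (bit_index j) = y (bit_index j)) ->
  address x k = address y k.
Proof.
elim: k => //= k IH h; rewrite h // IH // => j jk; apply: h.
exact: ltnW.
Qed.

(** Stage [k] is [lift_same_box] with [m = level k], applicable since addresses have depth 0. So
    exactly the stages of level at least [n] demand equality of a bit. *)
Lemma same_box_address n x y :
  (forall k, same_box (depth k) n (address x k) (address y k)) <->
  (forall k, n <= level k -> x (bit_index k) = y (bit_index k)).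
Proof.
have step k : same_box (depth k.+1) n (address x k.+1) (address y k.+1) <->
    same_box (depth k) n (address x k) (address y k) /\
    (level k < n \/ x (bit_index k) = y (bit_index k)).
  have h z : depth k (address z k) <= minn (level k) n by rewrite depth_address.
  exact: (lift_same_box (depthP k).1 (depthP k).2 _ _ (h x) (h y)).
split=> h.
  move=> k nk; have /step[_ []//] := h k.+1; lia.
elim=> [|k IH]; first by apply: same_box_refl.
apply/step; split=> //; have [|/h] := ltnP (level k) n; by [left|right].
Qed.

Lemma E1_address (x y : nat * nat -> bool) :
  (exists m, forall n, m <= n -> forall k, x (n, k) = y (n, k)) <->
  exists m, forall k, same_box (depth k) m (address x k) (address y k).
Proof.
split=> -[m h]; exists m.
  by apply/same_box_address => k /h; rewrite /level; case: (bit_index k).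
move=> n mn k; have /same_box_address h' := h.
have [j ej] := bit_index_surj (n, k).
by have := h' j; rewrite /level ej; apply.
Qed.

(** Properness bounds the box, so it has a least and a greatest element. *)
Lemma same_box_interval H m p : proper_walk H -> H p <= m ->
  exists a b, forall i, a <= i <= b <-> same_box H m i p.
Proof.
move=> [c Hc] hp.
have hpp := same_box_refl hp.
have exP : exists i, `[< same_box H m i p >] by exists p; apply/asboolP.
have bdP i : `[< same_box H m i p >] -> i <= m + c.
  by move/asboolP/same_boxl; have := Hc i; lia.
case: (ex_minnP exP) => a /asboolP ha amin.
case: (ex_maxnP exP bdP) => b /asboolP hb bmax.
exists a, b => i; split; last first.
  by move/asboolP => h; rewrite amin ?bmax.
move=> iab j hj.
have [|] : (minn a p <= j <= maxn a p) \/ (minn b p <= j <= maxn b p) by lia.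
  exact: ha.
exact: hb.
Qed.

End Walks.

(** * Planar topology *)

Section Extension.
Variables (R : realType).
Implicit Types (w : nat -> nat) (s t : R).

Definition walk_values w s : set R :=
  [set (w i)%:R + `|s - i%:R| | i in [set: nat]].

(* McShane's extension; any 1-Lipschitz extension of a walk is the piecewise
   linear one on the half-line. *)
Definition walk_ext w s : R := inf (walk_values w s).

Lemma walk_values_ge0 w s : lbound (walk_values w s) 0.
Proof. by move=> _ [i _ <-]; rewrite addr_ge0. Qed.

Lemma walk_ext_le w s i : walk_ext w s <= (w i)%:R + `|s - i%:R|.
Proof. by apply: ge_inf; [exists 0; exact: walk_values_ge0|exists i]. Qed.

Lemma le_walk_ext w s x : (forall i, x <= (w i)%:R + `|s - i%:R|) ->
  x <= walk_ext w s.
Proof.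
move=> h; apply: lb_le_inf; first by exists ((w 0%N)%:R + `|s - 0%:R|), 0%N.
by move=> _ [i _ <-].
Qed.

Lemma walk_ext_ge0 w s : 0 <= walk_ext w s.
Proof. by apply: le_walk_ext => i; rewrite addr_ge0. Qed.

Lemma walk_ext_lip w s t : `|walk_ext w s - walk_ext w t| <= `|s - t|.
Proof.
have h s' t' : walk_ext w s' - `|s' - t'| <= walk_ext w t'.
  apply: le_walk_ext => i; have := walk_ext_le w s' i.
  have := ler_distD t' s' i%:R; lra.
by have := h s t; have := h t s; rewrite distrC ler_norml; lra.
Qed.

Lemma walk_ext_continuous w : continuous (walk_ext w).
Proof.
move=> s; apply/cvgrPdist_le => e e0.
apply: (filterS _ (nbhsx_ballx s e e0)) => t /ltW.
exact: le_trans (walk_ext_lip _ _ _).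
Qed.

Lemma walk_ext_lower w (c : nat) s : (forall i, i <= w i + c)%N ->
  s - c%:R <= walk_ext w s.
Proof.
move=> h; apply: le_walk_ext => i.
have := h i; rewrite -(ler_nat R) natrD; have := ler_norm (s - i%:R); lra.
Qed.

Lemma walk_lip w i j : is_walk w -> (w i)%:R - (w j)%:R <= `|i%:R - j%:R| :> R.
Proof.
move=> [_ wS].
have h d a : (w (a + d) <= w a + d /\ w a <= w (a + d) + d)%N.
  elim: d => [|d]; first by rewrite addn0; lia.
  by rewrite addnS; have := wS (a + d)%N; lia.
case/orP: (leq_total i j) => ij; have := ij; rewrite -(ler_nat R) => ijR.
  have := (h (j - i)%N i).2; rewrite subnKC // -(ler_nat R) natrD natrB //.
  by rewrite ler0_norm; lra.
have := (h (i - j)%N j).1; rewrite subnKC // -(ler_nat R) natrD natrB //.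
by rewrite ger0_norm; lra.
Qed.

Lemma walk_ext_nat w i : is_walk w -> walk_ext w i%:R = (w i)%:R.
Proof.
move=> Ww; apply/eqP; rewrite eq_le; apply/andP; split.
  by have := walk_ext_le w i%:R i; rewrite subrr normr0 addr0.
apply: le_walk_ext => j; have := walk_lip i j Ww; lra.
Qed.

Lemma walk_ext_box w (a b a' b' : nat) s : is_walk w ->
  (forall i, a <= i <= b -> a' <= w i <= b')%N ->
  a%:R <= s <= b%:R -> a'%:R <= walk_ext w s <= b'%:R.
Proof.
move=> Ww h /andP[as_ sb].
have s0 : 0 <= s by apply: le_trans as_.
have /andP[ts st] := truncn_itv s0.
set i := Num.truncn s in ts st.
have ai : (a <= i)%N.
  by rewrite -ltnS -(ltr_nat R); apply: le_lt_trans st.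
have ib : (i <= b)%N by rewrite -(ler_nat R); apply: le_trans sb.
have [eb|ib'] : i = b \/ (i < b)%N by lia.
  have -> : s = i%:R by apply/le_anti; rewrite ts eb sb.
  by rewrite walk_ext_nat // !ler_nat h // ai ib.
have := h i; rewrite ai ib -2!(ler_nat R) => /(_ isT) hi.
have := h i.+1; rewrite (leqW ai) ib' -2!(ler_nat R) => /(_ isT) hi'.
(* As [w i] and [w i.+1] differ by exactly 1, the Lipschitz bounds from both ends leave only the
   linear interpolation. *)
have l1 := walk_ext_lip w s i%:R; have l2 := walk_ext_lip w s i.+1%:R.
rewrite !walk_ext_nat // !ler_norml in l1 l2.
rewrite ger0_norm in l1; last lra.
rewrite ler0_norm in l2; last lra.
rewrite -natr1 in l2 hi' st.
by case: Ww => _ /(_ i)[E|E]; move: hi' l2 l1 hi; rewrite E -natr1; lra.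
Qed.

End Extension.

(** * Decreasing sequences of compact sets *)

Section NestedIntersection.
Variables (R : realType) (T : pseudoMetricType R).
Variable D : nat -> set T.
Hypothesis hT : hausdorff_space T.
Hypothesis Dcompact : forall n, compact (D n).
Hypothesis Ddecr : forall n, D n.+1 `<=` D n.

Lemma nested_sub m n : (m <= n)%N -> D n `<=` D m.
Proof.
elim: n => [|n IH]; first by rewrite leqn0 => /eqP ->.
rewrite leq_eqVlt => /predU1P[->//|/IH h].
exact: subset_trans (@Ddecr n) h.
Qed.

(** A point outside the intersection has a neighbourhood missing some [D n]; compactness of [D 0]
    makes the index uniform. *)
Lemma nested_sub_open U : open U -> \bigcap_n D n `<=` U ->
  exists n, D n `<=` U.
Proof.
move=> oU DU.
have := (compact_near_coveringP (D 0%N)).1 (@Dcompact 0%N) nat \oo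
  (fun i x => D i x -> U x) _.
move=> []//.
  move=> x D0x; have [Ux|nUx] := pselect (U x).
    exists (U, setT); first by split; [exact: open_nbhs_nbhs|exact: filterT].
    by move=> [y i] [/= Uy _] _.
  have /existsNP[n nDn] : ~ forall n, D n x.
    by move=> h; apply: nUx; apply: DU => n _; exact: h.
  exists (~` D n, [set i | (n <= i)%N]).
    split => /=; last by exists n.
    apply: open_nbhs_nbhs; split => //; apply: closed_openC.
    exact: compact_closed.
  by move=> [y i] [/= nDy ni] /(nested_sub ni).
move=> N _ /(_ N (leqnn N)) h; exists N => y DNy.
by apply: h => //; exact: (nested_sub (leq0n N)).
Qed.

Lemma nested_compact : compact (\bigcap_n D n).
Proof.
apply: (subclosed_compact _ (@Dcompact 0%N)); last by move=> x; apply.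
by apply: closed_bigI => n _; exact: compact_closed.
Qed.

Lemma nested_nonempty : (forall n, D n !=set0) -> \bigcap_n D n !=set0.
Proof.
move=> D0; apply/set0P/eqP => e.
have [|n] := @nested_sub_open set0 open0; first by rewrite e.
by have [x Dx] := D0 n; move=> /(_ x Dx).
Qed.

(** Normality separates a clopen part of the intersection from the rest by disjoint open sets. Some
    [D n] lies in their union and, being connected, in one of them. *)
Lemma nested_connected : (forall n, connected (D n)) ->
  connected (\bigcap_n D n).
Proof.
move=> Dconn B [b Bb] [U oU BU] [F cF BF].
set C := \bigcap_n D n in BU BF *.
have cC : closed C by apply: compact_closed => //; exact: nested_compact.
have /(@normal_openP R) norm := @pseudometric_normal R T.
have [|||U1 [U2 [oU1 oU2 BU1 CU2 U12]]] := norm B (C `&` ~` U).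
- by rewrite BF; exact: closedI.
- by apply: closedI => //; exact: open_closedC.
- by rewrite BU; apply/seteqP; split => // x [[_ Ux] [_]].
have [||n Dn] := @nested_sub_open (U1 `|` U2); first exact: openU.
  move=> x Cx; have [Ux|nUx] := pselect (U x); [left|right].
    by apply: BU1; rewrite BU.
  by apply: CU2.
have CD : C `<=` D n by move=> x; apply.
have E : D n `&` U1 = D n.
  apply: Dconn.
  - by exists b; split; [apply: CD; rewrite BU in Bb; case: Bb|exact: BU1].
  - by exists U1.
  - exists (~` U2); first exact: open_closedC.
    apply/seteqP; split => x [Dx Ux]; split => //.
      by move=> U2x; have : (U1 `&` U2) x by []; rewrite U12.
    by case: (Dn _ Dx).
apply/seteqP; split; first by rewrite BU => x [].
move=> x Cx; rewrite BU; split => //; apply: contrapT => nUx.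
have U2x : U2 x by exact: CU2.
have : (D n `&` U1) x by rewrite E; exact: CD.
by case=> _ U1x; have : (U1 `&` U2) x by []; rewrite U12.
Qed.

End NestedIntersection.

(** * Compactness and connectedness in an initial topology *)

Section InitialTopology.
Variables (S : choiceType) (T : topologicalType) (f : S -> T).
Let W := initial_topology f.

(** Open sets are preimages under [f], so a cluster point of the image filter comes from one of the
    filter itself. *)
Lemma initial_compact (K : set W) : compact (f @` K) -> compact K.
Proof.
move=> cK F PF FK.
have FfK : (f @ (F : set_system S)) (f @` K).
  by apply: (@filterS _ F _ K) => // x Kx; exists x.
have [y [[x Kx <-] clx]] := cK (f @ (F : set_system S)) _ FfK.
exists x; split=> // B V FB [U [[ O oO <-]] /= Ofx OV].
have FfB : (f @ (F : set_system S)) (f @` B).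
  by apply: (@filterS _ F _ B) => // w Bw; exists w.
have [z [[w Bw <-] Ow]] := clx _ O FfB (open_nbhs_nbhs (conj oO Ofx)).
by exists w; split => //; exact: OV.
Qed.

Lemma initial_closed (F : set W) : closed F ->
  exists2 G : set T, closed G & F = f @^-1` G.
Proof.
move=> /closed_openC [ O oO e]; exists (~` O); first exact: open_closedC.
by rewrite -[F]setCK -e.
Qed.

Lemma initial_connected (K : set W) : connected (f @` K) -> connected K.
Proof.
move=> cK B [b Bb] [U [ O oO <-] BU] [F /initial_closed[G cG ->] BF].
have e : f @` B = f @` K.
  apply: cK; first by exists (f b), b.
  - exists O => //; apply/seteqP; split.
      by move=> _ [x + <-]; rewrite BU => -[Kx Ox]; split => //; exists x.
    by move=> _ [[x Kx <-] Ox]; exists x => //; rewrite BU.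
  - exists G => //; apply/seteqP; split.
      by move=> _ [x + <-]; rewrite BF => -[Kx Ox]; split => //; exists x.
    by move=> _ [[x Kx <-] Ox]; exists x => //; rewrite BF.
apply/seteqP; split; first by rewrite BU => x [].
move=> x Kx; have : (f @` B) (f x) by rewrite e; exists x.
by rewrite BU => -[y [Ky Oy] exy]; split => //; rewrite /preimage/= -exy.
Qed.

End InitialTopology.

Lemma image_set_val_setT {T : Type} (A : set T) :
  set_val @` [set: set_type A] = A.
Proof.
apply/seteqP; split => [_ [[x Ax] _ <-]|x Ax]; first exact: set_mem.
by exists (exist _ x (mem_set Ax)).
Qed.

Lemma metrizable_of_dist (R : realType) (T : pseudoMetricType R)
    (d : T -> T -> R) :
  (forall x y, 0 <= d x y) -> (forall x y, d x y = 0 -> x = y) ->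
  (forall x e, ball x e = [set y | d x y < e]) -> metrizable R T.
Proof.
move=> d0 dpos dball.
pose M : metricType R := Metric.Pack (Metric.Class
  (@PseudoMetric_isMetric.Axioms_ R T _ _ _ _ _ _ _ d d0 dpos dball)).
by exists M; exists id; exists id; split => // x; exact: cvg_id.
Qed.

(** * Subspaces of the plane *)

Section SubspaceOfPlane.
Variables (R : realType).
Implicit Types (X : set (R * R)%type).

Lemma plane_hausdorff : hausdorff_space (R * R)%type.
Proof.
exact: (@norm_hausdorff R (R * R)%type).
Qed.

Lemma metrizable_subset X (C : set (set_type X)) : metrizable R (set_type C).
Proof.
pose T := set_type C.
pose v (x : T) : R * R := set_val (set_val x).
pose d (x y : T) : R := Num.max `|(v x).1 - (v y).1| `|(v x).2 - (v y).2|.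
have d0 x y : 0 <= d x y by rewrite /d le_max normr_ge0.
have dpos x y : d x y = 0 -> x = y.
  move=> dxy; apply/val_inj/val_inj.
  have : d x y <= 0 by rewrite dxy.
  rewrite /d ge_max !normr_le0 !subr_eq0 => /andP[/eqP e1 /eqP e2].
  by rewrite [LHS](surjective_pairing (v x)) [RHS](surjective_pairing (v y)) e1 e2.
have dball x e : ball x e = [set y | d x y < e].
  apply/seteqP; split => y /=.
    by move=> [b1 b2]; rewrite /d gt_max; apply/andP.
  by rewrite /d gt_max => /andP[b1 b2].
exact: (metrizable_of_dist d0 dpos dball).
Qed.

(** A continuum of [X] lives on a subtype of a subtype, so each transfer to or from the plane goes
    through two projections; metrizability is automatic. *)
Lemma continuum_connectedP X (p q : set_type X) :
  continuum_connected R p q <->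
  exists D : set (R * R)%type,
    [/\ D `<=` X, compact D, connected D, D (set_val p) & D (set_val q)].
Proof.
split.
  move=> [C [[_ cC kC _] Cp Cq]].
  pose v (x : set_type C) : R * R := set_val (set_val x).
  have vc : continuous v.
    move=> x; apply: continuous_comp; apply: initial_continuous.
  exists (v @` setT); split.
  - by move=> _ [x _ <-]; exact: set_valP.
  - apply: continuous_compact => //; exact: continuous_subspaceT.
  - apply: connected_continuous_connected => //; exact: continuous_subspaceT.
  - by exists (exist _ p (mem_set Cp)).
  - by exists (exist _ q (mem_set Cq)).
move=> [D [DX cD kD Dp Dq]].
pose C : set (set_type X) := set_val @^-1` D.
have eC : set_val @` C = D.
  apply/seteqP; split => [_ [x Cx <-]//|x Dx].
  by exists (exist _ x (mem_set (DX x Dx))).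
exists C; split => //; split.
- by exists (exist _ p (mem_set (Dp : C p))).
- apply: initial_compact; rewrite image_set_val_setT.
  by apply: initial_compact; rewrite eC.
- apply: initial_connected; rewrite image_set_val_setT.
  by apply: initial_connected; rewrite eC.
- exact: metrizable_subset.
Qed.

(** A closed square centred at the point meets the closed set [X] in a compact set. *)
Lemma closed_locally_compact X : closed X -> locally_compact [set: set_type X].
Proof.
move=> cX p _; set a := (set_val p : R * R).
pose K : set (R * R) := `[a.1 - 1, a.1 + 1] `*` `[a.2 - 1, a.2 + 1].
have cK : compact K by apply: compact_setX; exact: segment_compact.
exists (set_val @^-1` K).
  apply: (@filterS _ (nbhs p) _ (set_val @^-1` K)) => // .
  apply: initial_continuous.
  exists ([set` `[a.1 - 1, a.1 + 1]], [set` `[a.2 - 1, a.2 + 1]]) => //.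
  split => /=; apply: (filterS _ (nbhsx_ballx _ 1 ltr01)) => y;
    by rewrite /ball /= in_itv /= ltr_norml; lra.
split.
  apply: initial_compact.
  have -> : set_val @` (set_val @^-1` K : set (set_type X)) = X `&` K.
    apply/seteqP; split => [_ [x Kx <-]|x [Xx Kx]].
      by split => //; exact: set_valP.
    by exists (exist _ x (mem_set Xx)).
  rewrite setIC; apply: compact_closedI => //.
have vc : continuous (set_val : set_type X -> R * R) by exact: initial_continuous.
move: K cK => K cK; move/continuous_closedP: vc; apply.
apply: compact_closed => //; exact: plane_hausdorff.
Qed.

End SubspaceOfPlane.

(** * The attractor *)

Section Plane.
Variable (R : realType).
Implicit Types (p q : (R * R)%type).

Definition scale (k : nat) : R := (4^-1) ^+ k.

Lemma scale_gt0 k : 0 < scale k. Proof. by rewrite exprn_gt0 // invr_gt0. Qed.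

Lemma scale0 : scale 0 = 1. Proof. exact: expr0. Qed.

Lemma scaleS k : scale k = 4 * scale k.+1.
Proof. by rewrite /scale exprS mulrA mulfV ?mul1r. Qed.

Lemma scale_le1 k : scale k <= 1.
Proof.
elim: k => [|k IH]; first by rewrite scale0.
by have := scaleS k; have := scale_gt0 k.+1; lra.
Qed.

(* On the attractor the (k+2)-nd coordinate is at most the 0-th one plus
   [defect k.+2], so this makes the k-th perturbation at most
   [4^-(k+1) (1 + s_0)]. *)
Definition coupling (k : nat) : R := scale k.+1 / (defect k.+2).+1%:R.

Lemma coupling_gt0 k : 0 < coupling k.
Proof. by rewrite divr_gt0 // scale_gt0. Qed.

(** With [d] the defect, [1 <= a] gives [d + a <= d.+1 * a], and the denominator of [coupling]
    cancels [d.+1]. *)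
Lemma coupling_mul_le k (x a : R) : 0 <= x -> 1 <= a ->
  x <= (defect k.+2)%:R + a -> coupling k * x <= scale k.+1 * a.
Proof.
move=> x0 a1 xa; rewrite /coupling -mulrA ler_pM2l ?scale_gt0 //.
rewrite mulrC ler_pdivrMr // -natr1.
have d0 : 0 <= (defect k.+2)%:R :> R by [].
by nra.
Qed.

Lemma coupling_le1 k : coupling k <= 1.
Proof.
have := @coupling_mul_le k 1 1; rewrite !mulr1 => h.
apply: le_trans (scale_le1 k.+1); apply: h => //.
by rewrite lerDr.
Qed.

Definition walk_map (k : nat) : R -> R := walk_ext (walk k).

(** The recurrence on pairs [(s_k, s_(k+1))], solved for [s_(k+2)]; [plane_prev] is its inverse. *)
Definition plane_next k q : R * R := (q.2, (q.1 - walk_map k q.2) / coupling k).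

Definition plane_prev k q : R * R := (walk_map k q.1 + coupling k * q.2, q.1).

Fixpoint plane_orbit p (k : nat) : R * R :=
  if k is k'.+1 then plane_next k' (plane_orbit p k') else p.

Fixpoint pullback (k : nat) q : R * R :=
  if k is k'.+1 then pullback k' (plane_prev k' q) else q.

Definition coordinate p k : R := (plane_orbit p k).1.

Lemma plane_nextK k : cancel (plane_next k) (plane_prev k).
Proof.
move=> [a b]; rewrite /plane_prev /plane_next /= mulrC divfK ?gt_eqF ?coupling_gt0 //.
by rewrite addrC subrK.
Qed.

Lemma plane_prevK k : cancel (plane_prev k) (plane_next k).
Proof.
move=> [a b]; rewrite /plane_prev /plane_next /= addrAC subrr add0r mulrC mulKf //.
by rewrite gt_eqF ?coupling_gt0.
Qed.

Lemma plane_orbit_pullback k q : plane_orbit (pullback k q) k = q.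
Proof. by elim: k q => //= k IH q; rewrite IH plane_prevK. Qed.

Lemma pullback_orbit k p : pullback k (plane_orbit p k) = p.
Proof. by elim: k => //= k IH; rewrite plane_nextK. Qed.

Lemma coordinate_rec p k :
  coordinate p k = walk_map k (coordinate p k.+1) + coupling k * coordinate p k.+2.
Proof. by rewrite /coordinate -{1}(plane_nextK k (plane_orbit p k)). Qed.

Lemma walk_map_continuous k : continuous (walk_map k).
Proof. exact: walk_ext_continuous. Qed.

Lemma pair_continuous (T : topologicalType) (f g : T -> R) :
  continuous f -> continuous g -> continuous (fun x => (f x, g x) : R * R).
Proof. by move=> cf cg x; have := cvg_pair (cf x) (cg x); exact. Qed.

Lemma fst_continuous : continuous (fst : R * R -> R).
Proof. by move=> x; exact: cvg_fst. Qed.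

Lemma snd_continuous : continuous (snd : R * R -> R).
Proof. by move=> x; exact: cvg_snd. Qed.

Lemma plane_next_continuous k : continuous (plane_next k).
Proof.
apply: pair_continuous; first exact: snd_continuous.
move=> q; apply: cvgM; last exact: cvg_cst.
apply: cvgB; first exact: fst_continuous.
by apply: (@continuous_comp _ _ _ snd (walk_map k));
  [exact: snd_continuous|exact: walk_map_continuous].
Qed.

Lemma plane_prev_continuous k : continuous (plane_prev k).
Proof.
apply: pair_continuous; last exact: fst_continuous.
move=> q; apply: cvgD; last first.
  by apply: cvgM; [exact: cvg_cst|exact: snd_continuous].
by apply: (@continuous_comp _ _ _ fst (walk_map k));
  [exact: fst_continuous|exact: walk_map_continuous].
Qed.

Lemma plane_orbit_continuous k : continuous (plane_orbit ^~ k).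
Proof.
elim: k => [|k IH] p /=; first exact: cvg_id.
by apply: (@continuous_comp _ _ _ (plane_orbit ^~ k) (plane_next k));
  [exact: IH|exact: plane_next_continuous].
Qed.

Lemma pullback_continuous k : continuous (pullback k).
Proof.
elim: k => [|k IH] p /=; first exact: cvg_id.
by apply: (@continuous_comp _ _ _ (plane_prev k) (pullback k));
  [exact: plane_prev_continuous|exact: IH].
Qed.

Lemma coordinate_continuous k : continuous (coordinate ^~ k).
Proof.
move=> p; apply: (@continuous_comp _ _ _ (plane_orbit ^~ k) fst).
  exact: plane_orbit_continuous.
exact: fst_continuous.
Qed.

Definition attractor : set (R * R) := [set p | forall k, 0 <= coordinate p k].

Lemma attractor_closed : closed attractor.
Proof.
have -> : attractor = \bigcap_k (coordinate ^~ k @^-1` [set x | 0 <= x]).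
  by apply/seteqP; split => [p Xp k _|p Xp k]; exact: Xp.
apply: closed_bigI => k _; have /continuous_closedP := @coordinate_continuous k.
by apply; exact: closed_ge.
Qed.

(** Since the perturbation is nonnegative, [s_k >= g_k s_(k+1)], and [g_k] lowers its argument by at
    most [walk_defect k]. *)
Lemma coordinate_le p k : attractor p ->
  coordinate p k <= coordinate p 0 + (defect k)%:R.
Proof.
move=> Xp; elim: k => [|k IH] /=; first by rewrite addr0.
have := walk_ext_lower (coordinate p k.+1) (@walk_defectP k).
have := coordinate_rec p k; have := mulr_ge0 (ltW (coupling_gt0 k)) (Xp k.+2).
by rewrite natrD /walk_map; lra.
Qed.

Lemma perturbation_le p k : attractor p ->
  0 <= coupling k * coordinate p k.+2 <= scale k.+1 * (1 + coordinate p 0).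
Proof.
move=> Xp; rewrite mulr_ge0 ?(ltW (coupling_gt0 k)) //=.
apply: coupling_mul_le => //; first by have := Xp 0; lra.
by have := coordinate_le k.+2 Xp; lra.
Qed.

Fixpoint depth_map (k : nat) : R -> R :=
  if k is k'.+1 then depth_map k' \o walk_map k' else id.

Lemma depth_map_nat k i : depth_map k i%:R = (depth k i)%:R.
Proof.
elim: k i => //= k IH i; rewrite /walk_map walk_ext_nat ?IH //.
exact: walkP.
Qed.

Lemma depth_map_lip k s t : `|depth_map k s - depth_map k t| <= `|s - t|.
Proof.
elim: k s t => //= k IH s t; apply: le_trans (IH _ _) _.
exact: walk_ext_lip.
Qed.

Lemma depth_map_coordinate p k : attractor p ->
  depth_map k (coordinate p k) <= 1 + coordinate p 0 *+ 2.
Proof.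
move=> Xp; have p0 := Xp 0.
(* The perturbations [4^-(j+1) (1 + s_0)] form a geometric series; [1 - scale k] grows at each step
   by three times the amount required. *)
suff : depth_map k (coordinate p k) <=
    coordinate p 0 + (1 + coordinate p 0) * (1 - scale k).
  by have := scale_gt0 k; rewrite mulr2n; nra.
elim: k => [|k IH]; first by rewrite scale0 subrr mulr0 addr0.
have := depth_map_lip k (walk_map k (coordinate p k.+1)) (coordinate p k).
rewrite ler_norml /= => /andP[_ l].
have /andP[e0 e1] := perturbation_le k Xp.
rewrite [in X in _ <= X](coordinate_rec p k) in l.
rewrite ler0_norm in l; last lra.
by have := scaleS k; nra.
Qed.

Lemma depth_near p k i (c : R) : attractor p -> `|i%:R - coordinate p k| <= c ->
  (depth k i)%:R <= 1 + coordinate p 0 *+ 2 + c.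
Proof.
move=> Xp ic; have := depth_map_coordinate k Xp.
have := depth_map_lip k i%:R (coordinate p k); rewrite depth_map_nat ler_norml.
lra.
Qed.

(** The combinatorial form of continuum connection on the attractor, through which both reductions
    pass. *)
Definition same_thread p q := exists m, forall k i, (m < depth k i)%N ->
  (i%:R < coordinate p k) = (i%:R < coordinate q k).

(** On [D] the 0-th coordinate is bounded, so no coordinate equals an integer of large depth; the
    values of each coordinate form an interval, which then lies on one side of that integer. *)
Lemma same_thread_sub_connected (D : set (R * R)) p q :
  D `<=` attractor -> compact D -> connected D -> D p -> D q -> same_thread p q.
Proof.
move=> DX cD kD Dp Dq.
have cD0 : compact (coordinate ^~ 0%N @` D).
  apply: continuous_compact => //; apply: continuous_subspaceT.
  exact: coordinate_continuous.
have [B [_ /(_ (B + 1)) HB]] := compact_bounded cD0.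
have {}HB z : D z -> coordinate z 0 <= B + 1.
  move=> Dz; apply: le_trans (ler_norm _) _; apply: HB; first by rewrite ltrDl.
  by exists z.
have := HB _ Dp; have p0 := DX _ Dp 0 => B0.
(* The number [1 + (B + 1) *+ 2] is the bound of [depth_map_coordinate] when the 0-th coordinate is
   at most [B + 1]. *)
have /andP[_ mB] : (Num.truncn (1 + (B + 1) *+ 2 : R))%:R <= 1 + (B + 1) *+ 2 <
    (Num.truncn (1 + (B + 1) *+ 2 : R)).+1%:R.
  by apply: truncn_itv; rewrite mulr2n; lra.
set m := (Num.truncn _).+1 in mB.
exists m => k i mi.
have Ik : is_interval (coordinate ^~ k @` D).
  apply/connected_intervalP; apply: connected_continuous_connected => //.
  by apply: continuous_subspaceT; exact: coordinate_continuous.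
have no z : D z -> coordinate z k <> i%:R.
  move=> Dz e; have := depth_map_coordinate k (DX _ Dz).
  rewrite e depth_map_nat; have := HB _ Dz; move: mi.
  rewrite -(ltr_nat R) !mulr2n in mB *.
  lra.
have h z w : D z -> D w -> i%:R < coordinate z k -> i%:R < coordinate w k.
  move=> Dz Dw iz; rewrite ltNge; apply/negP => wi.
  have [|||y Dy yi] := Ik (coordinate w k) (coordinate z k) _ _ i%:R.
  - by exists w.
  - by exists z.
  - by rewrite wi ltW.
  - exact: (no y).
by apply/idP/idP; exact: h.
Qed.

End Plane.

Lemma connected_pairwise (T : topologicalType) (A : set T) :
  (forall x y, A x -> A y -> exists C, [/\ C `<=` A, connected C, C x & C y]) ->
  connected A.
Proof.
move=> h; have [->|/set0P[x Ax]] := eqVneq A set0; first exact: connected0.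
have {}h y : exists C, A y -> [/\ C `<=` A, connected C, C x & C y].
  have [Ay|nAy] := pselect (A y); last by exists set0.
  by have [C hC] := h x y Ax Ay; exists C.
pose C y := sval (cid (h y)).
have hC y : A y -> [/\ C y `<=` A, connected (C y), C y x & C y y].
  exact: (svalP (cid (h y))).
have -> : A = \bigcup_(y in A) C y.
  apply/seteqP; split => [y Ay|z [y Ay Cz]].
    by exists y => //; case: (hC y Ay).
  by have [CA _ _ _] := hC y Ay; exact: CA.
apply: bigcup_connected; first by exists x => y Ay; case: (hC y Ay).
by move=> y Ay; case: (hC y Ay).
Qed.

(** * Nested rectangles along a sequence of integer intervals *)

Section Boxes.
Variable (R : realType).
Implicit Types (p q : (R * R)%type).

Lemma rectangle_connected (a b c d : R) :
  connected (`[a, b] `*` `[c, d] : set (R * R)).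
Proof.
apply: connected_pairwise => -[x1 x2] [y1 y2] [/= + +] [/= + +].
rewrite !in_itv /= => /andP[x11 x12] /andP[x21 x22] /andP[y11 y12] /andP[y21 y22].
pose f (t : R) : R * R := (x1 + t * (y1 - x1), x2 + t * (y2 - x2)).
exists (f @` `[0, 1]); split.
- move=> z [t /=]; rewrite in_itv /= => /andP[t0 t1] <-{z}.
  by split; rewrite /= in_itv /=; nra.
- apply: connected_continuous_connected; first exact: segment_connected.
  apply: continuous_subspaceT; apply: pair_continuous => t.
    apply: cvgD; first exact: cvg_cst.
    by apply: cvgM; [exact: cvg_id|exact: cvg_cst].
  apply: cvgD; first exact: cvg_cst.
  by apply: cvgM; [exact: cvg_id|exact: cvg_cst].
- by exists 0; [rewrite /= in_itv /= lexx ler01|rewrite /f !mul0r !addr0].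
- exists 1; first by rewrite /= in_itv /= lexx ler01.
  by rewrite /f !mul1r !(addrC _ (_ - _)) !subrK.
Qed.

Variables (a b : nat -> nat) (M : nat).
Hypothesis ab : forall k, (a k <= b k)%N.
Hypothesis walk_ab : forall k i, (a k.+1 <= i <= b k.+1)%N ->
  (a k <= walk k i <= b k)%N.
Hypothesis bM : forall k, (b k <= defect k + M)%N.

(** Pulling back one stage costs at most [margin k.+1] for the walk and twice that for the
    perturbation, which fits into [margin k], four times as large. *)
Definition margin (k : nat) : R := M.+1%:R * scale R k.
(** Cutting at 0 keeps the intersection inside the attractor. *)
Definition box_lo (k : nat) : R := Num.max 0 ((a k)%:R - margin k).
Definition box_hi (k : nat) : R := (b k)%:R + margin k.

Lemma margin_gt0 k : 0 < margin k.
Proof. by rewrite mulr_gt0 // scale_gt0. Qed.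

Lemma marginS k : margin k = 4 * margin k.+1.
Proof. by rewrite /margin (scaleS _ k) mulrCA. Qed.

Lemma abR k : (a k)%:R <= (b k)%:R :> R. Proof. by rewrite ler_nat. Qed.

Definition box (k : nat) : set (R * R) :=
  `[box_lo k, box_hi k] `*` `[box_lo k.+1, box_hi k.+1].

Lemma walk_map_box k (s : R) : box_lo k.+1 <= s <= box_hi k.+1 ->
  (a k)%:R - margin k.+1 <= walk_map k s <= (b k)%:R + margin k.+1.
Proof.
rewrite /box_lo /box_hi ge_max => /andP[/andP[s0 s1] s2].
(* Clamping [s] to the integer interval moves it by at most the margin. *)
pose s' := Num.max (a k.+1)%:R (Num.min s (b k.+1)%:R).
have abk := abR k.+1; have mg := margin_gt0 k.+1.
have s'ab : (a k.+1)%:R <= s' <= (b k.+1)%:R.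
  by rewrite /s' le_max lexx ge_max abk ge_min lexx orbT.
have /andP[l1 l2] := walk_ext_box (walkP k) (@walk_ab k) s'ab.
have ss' : `|s - s'| <= margin k.+1.
  rewrite /s'; case: (lerP s (b k.+1)%:R) => h.
    by case: (lerP (a k.+1)%:R s) => h'; rewrite ler_norml; lra.
  by rewrite (max_r abk) ler_norml; lra.
have := le_trans (walk_ext_lip (walk k) s s') ss'; rewrite ler_norml /walk_map.
by move: l1 l2; lra.
Qed.

Lemma plane_prev_box k q : box k.+1 q -> box k (plane_prev k q).
Proof.
case: q => s t [/= + +]; rewrite !in_itv /= => hs ht.
have /andP[w1 w2] := walk_map_box hs.
split => /=; rewrite in_itv /=; last exact: hs.
have w0 : 0 <= walk_map k s by exact: walk_ext_ge0.
move: ht; rewrite {1}/box_lo ge_max => /andP[/andP[t0 _] t2].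
have ct0 := mulr_ge0 (ltW (coupling_gt0 R k)) t0.
(* Here [t <= b k.+2 + margin k.+2 <= defect k.+2 + M + M.+1]. *)
have ct : coupling R k * t <= scale R k.+1 * (M.+1%:R *+ 2).
  apply: coupling_mul_le => //.
    by rewrite mulr2n -!natr1; have : 0 <= M%:R :> R by []; lra.
  apply: le_trans t2 _; rewrite /box_hi.
  have := bM k.+2; rewrite -(ler_nat R) natrD => h1.
  have : margin k.+2 <= M.+1%:R by rewrite /margin ler_piMr // scale_le1.
  by rewrite mulr2n -!natr1; lra.
have e : scale R k.+1 * (M.+1%:R *+ 2) = 2 * margin k.+1.
  by rewrite /margin mulr2n; ring.
have := marginS k; have := margin_gt0 k.+1.
by rewrite /box_lo /box_hi ge_max; lra.
Qed.

(** These are the points whose coordinates [k] and [k.+1] lie in the rectangle [box k]. *)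
Definition nested_box (k : nat) : set (R * R) := pullback k @` box k.

Definition thread_box : set (R * R) :=
  [set p | forall k, box_lo k <= coordinate p k <= box_hi k].

Lemma thread_boxE : thread_box = \bigcap_k nested_box k.
Proof.
apply/seteqP; split => p.
  move=> h k _; exists (plane_orbit p k); last exact: pullback_orbit.
  by split; rewrite /= in_itv /=; [exact: (h k)|exact: (h k.+1)].
move=> h k; have [q [+ _] <-] := h k I.
by rewrite /coordinate plane_orbit_pullback /= in_itv.
Qed.

Lemma nested_box_compact k : compact (nested_box k).
Proof.
apply: continuous_compact.
  by apply: continuous_subspaceT; exact: pullback_continuous.
by apply: compact_setX; exact: segment_compact.
Qed.

Lemma nested_box_connected k : connected (nested_box k).
Proof.
apply: connected_continuous_connected; first exact: rectangle_connected.
by apply: continuous_subspaceT; exact: pullback_continuous.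
Qed.

Lemma nested_boxS k : nested_box k.+1 `<=` nested_box k.
Proof.
move=> _ [q hq <-]; exists (plane_prev k q) => //; exact: plane_prev_box.
Qed.

Lemma nested_box_nonempty k : nested_box k !=set0.
Proof.
exists (pullback k ((a k)%:R, (a k.+1)%:R)).
exists ((a k)%:R, (a k.+1)%:R) => //.
have h j : box_lo j <= (a j)%:R <= box_hi j.
  have := margin_gt0 j; have := abR j; rewrite /box_lo /box_hi ge_max ler0n /=.
  lra.
by split; rewrite /= in_itv /=.
Qed.

Lemma thread_box_compact : compact thread_box.
Proof.
rewrite thread_boxE; apply: nested_compact nested_box_compact.
exact: plane_hausdorff.
Qed.

Lemma thread_box_connected : connected thread_box.
Proof.
rewrite thread_boxE; apply: (@nested_connected R).
- exact: plane_hausdorff.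
- exact: nested_box_compact.
- exact: nested_boxS.
- exact: nested_box_connected.
Qed.

Lemma thread_box_nonempty : thread_box !=set0.
Proof.
rewrite thread_boxE; apply: nested_nonempty.
- exact: plane_hausdorff.
- exact: nested_box_compact.
- exact: nested_boxS.
- exact: nested_box_nonempty.
Qed.

Lemma thread_box_sub : thread_box `<=` @attractor R.
Proof.
by move=> p h k; have := h k; rewrite /box_lo ge_max => /andP[/andP[]].
Qed.

Lemma thread_boxP p : attractor p ->
  (forall k, (a k)%:R <= coordinate p k <= (b k)%:R) -> thread_box p.
Proof.
move=> Xp h k; have := h k; have := Xp k; have := margin_gt0 k.
by rewrite /box_lo /box_hi ge_max; lra.
Qed.

End Boxes.

(** * Continua and points obtained from the nested rectangles *)

Section Threads.
Variable (R : realType).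
Implicit Types (p q : (R * R)%type).

Definition whole (p : R * R) (k : nat) : nat := Num.truncn (coordinate p k).

Lemma whole_itv p k : attractor p ->
  (whole p k)%:R <= coordinate p k < (whole p k).+1%:R.
Proof. by move=> Xp; apply: truncn_itv; exact: Xp. Qed.

(** For a suitable [M], the [M]-boxes around the integer parts of [p] are mapped into each other by
    the walks, and the thread box over them contains both points. *)
Lemma same_thread_connected p q : attractor p -> attractor q -> same_thread p q ->
  exists D : set (R * R),
    [/\ D `<=` @attractor R, compact D, connected D, D p & D q].
Proof.
move=> Xp Xq [m hm].
have p0 := Xp 0%N; have q0 := Xq 0%N.
(* [B] dominates the bound of [depth_near] with [c = 2 + s_0] at both points. This [c] covers the
   integer parts, their successors, and the walk image of the next integer part, which is off by at
   most 1 plus a perturbation of at most [1 + s_0]. *)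
pose B : R := 3 + coordinate p 0 *+ 3 + coordinate q 0 *+ 3.
pose M := (m + (Num.truncn B).+1)%N.
have BM : B <= M%:R.
  have /andP[_ h] : (Num.truncn B)%:R <= B < (Num.truncn B).+1%:R.
    by apply: truncn_itv; rewrite /B !mulrSr; lra.
  by apply: le_trans (ltW h) _; rewrite ler_nat /M leq_addl.
have deep z k i : attractor z -> 1 + coordinate z 0 *+ 2 + (2 + coordinate z 0) <= B ->
    `|i%:R - coordinate z k| <= 2 + coordinate z 0 -> (depth k i <= M)%N.
  move=> Xz hz hi; rewrite -(ler_nat R); apply: le_trans BM; apply: le_trans hz.
  exact: depth_near.
have Bp : 1 + coordinate p 0 *+ 2 + (2 + coordinate p 0) <= B.
  by rewrite /B !mulrSr; lra.
have Bq : 1 + coordinate q 0 *+ 2 + (2 + coordinate q 0) <= B.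
  by rewrite /B !mulrSr; lra.
have near0 z k : attractor z ->
    `|(whole z k)%:R - coordinate z k| <= 2 + coordinate z 0.
  move=> Xz; have := whole_itv k Xz; have := Xz 0%N; rewrite -natr1 ler_norml.
  lra.
have near1 z k : attractor z ->
    `|(whole z k).+1%:R - coordinate z k| <= 2 + coordinate z 0.
  move=> Xz; have := whole_itv k Xz; have := Xz 0%N; rewrite -natr1 ler_norml.
  lra.
have boxS z k : attractor z -> 1 + coordinate z 0 *+ 2 + (2 + coordinate z 0) <= B ->
    same_box (depth k) M (whole z k).+1 (whole z k).
  move=> Xz hz i hi; have [->|->] : i = whole z k \/ i = (whole z k).+1 by lia.
    by apply: (deep z) => //; exact: near0.
  by apply: (deep z) => //; exact: near1.
(* An integer deeper than [M] between the two integer parts differs from both, so it would separate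
   the coordinates of [p] and [q]. *)
have box_pq k : same_box (depth k) M (whole q k) (whole p k).
  have Dp := same_boxr (boxS p k Xp Bp).
  have Dq := same_boxr (boxS q k Xq Bq).
  move=> i hi; rewrite leqNgt; apply/negP => Mi.
  have mi : (m < depth k i)%N by rewrite /M in Mi; lia.
  have ip : i <> whole p k by move=> e; rewrite e in Mi; lia.
  have iq : i <> whole q k by move=> e; rewrite e in Mi; lia.
  have /andP[p1 p2] := whole_itv k Xp; have /andP[q1 q2] := whole_itv k Xq.
  have := hm k i mi.
  have [h|h] : ((whole p k).+1 <= i /\ i.+1 <= whole q k)%N \/
     ((whole q k).+1 <= i /\ i.+1 <= whole p k)%N by lia.
    case: h; rewrite -2!(ler_nat R) => h1 h2.
    have -> : (i%:R < coordinate p k) = false by apply/negbTE; rewrite -leNgt; lra.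
    by have -> : (i%:R < coordinate q k) by rewrite -natr1 in h2; lra.
  case: h; rewrite -2!(ler_nat R) => h1 h2.
  have -> : (i%:R < coordinate q k) = false by apply/negbTE; rewrite -leNgt; lra.
  by have -> : (i%:R < coordinate p k) by rewrite -natr1 in h2; lra.
have box_walk k : same_box (depth k) M (walk k (whole p k.+1)) (whole p k).
  have hw : `|(walk k (whole p k.+1))%:R - coordinate p k| <= 2 + coordinate p 0.
    have := walk_ext_lip (walk k) (whole p k.+1)%:R (coordinate p k.+1).
    rewrite walk_ext_nat => [lip|]; last exact: walkP.
    have rec := coordinate_rec p k; rewrite /walk_map in rec.
    have /andP[e0 e1] := perturbation_le k Xp.
    have := whole_itv k.+1 Xp; rewrite -natr1 => w.
    have e2 : scale R k.+1 * (1 + coordinate p 0) <= 1 + coordinate p 0.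
      by rewrite ler_piMl ?scale_le1 //; lra.
    rewrite ler_norml in lip; rewrite ler_norml; rewrite ler0_norm in lip; lra.
  move=> i; case/andP; rewrite geq_min leq_max => i1 i2.
  apply: (deep p) => //; have := near0 p k Xp; move: hw; rewrite !ler_norml.
  by move: i1 i2; rewrite -!(ler_nat R); case/orP => ?; case/orP => ?; lra.
have exab k : exists ab : nat * nat, forall i,
    (ab.1 <= i <= ab.2)%N <-> same_box (depth k) M i (whole p k).
  have [a [b h]] := same_box_interval (depthP k).2 (same_boxr (box_pq k)).
  by exists (a, b).
pose a k := (sval (cid (exab k))).1; pose b k := (sval (cid (exab k))).2.
have hab k i : (a k <= i <= b k)%N <-> same_box (depth k) M i (whole p k).
  exact: (svalP (cid (exab k))).
have pab k : (a k <= whole p k <= b k)%N.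
  by apply/hab/same_box_refl; exact: same_boxr (box_pq k).
have ab k : (a k <= b k)%N by have := pab k; lia.
have wab k i : (a k.+1 <= i <= b k.+1)%N -> (a k <= walk k i <= b k)%N.
  move=> /hab h; apply/hab; apply: same_box_trans (box_walk k).
  by apply: same_box_walk h; exact: walkP.
have bM k : (b k <= defect k + M)%N.
  have /hab/same_boxl h : (a k <= b k <= b k)%N by rewrite ab leqnn.
  by have := defectP k (b k); lia.
have inbox z : attractor z -> 1 + coordinate z 0 *+ 2 + (2 + coordinate z 0) <= B ->
    (forall k, same_box (depth k) M (whole z k) (whole p k)) ->
    forall k, (a k)%:R <= coordinate z k <= (b k)%:R.
  move=> Xz hz h k; have /andP[z1 z2] := whole_itv k Xz.
  have /andP[h1 _] : (a k <= whole z k <= b k)%N by apply/hab.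
  (* The successor of the integer part is in the box too, so the coordinate does not pass [b k]. *)
  have /andP[_ h2] : (a k <= (whole z k).+1 <= b k)%N.
    by apply/hab; apply: same_box_trans (h k); exact: boxS.
  by move: h1 h2; rewrite -2!(ler_nat R); lra.
exists (thread_box (R := R) a b M); split.
- exact: thread_box_sub.
- exact: thread_box_compact.
- exact: thread_box_connected.
- apply: thread_boxP => //; apply: inbox => // k; apply: same_box_refl.
  exact: same_boxr (box_pq k).
- by apply: thread_boxP => //; apply: inbox.
Qed.

(** The integer intervals shrink to the single points [address x k], with [M = 0], so the margin is
    [scale R k]. *)
Lemma address_point (x : nat * nat -> bool) : exists p : R * R, attractor p /\
  forall k, `|coordinate p k - (address x k)%:R| <= scale R k.
Proof.
have [p hp] : thread_box (R := R) (address x) (address x) 0 !=set0.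
  apply: thread_box_nonempty => // k.
    move=> i hi; have -> : i = address x k.+1 by lia.
    by rewrite walk_address !leqnn.
  by rewrite addn0; have := defectP k (address x k); rewrite depth_address.
exists p; split; first exact: thread_box_sub hp.
move=> k; have := hp k; rewrite /box_lo /box_hi ge_max /margin mul1r ler_norml.
lra.
Qed.

End Threads.

(** * Reductions *)

Section Addresses.
Variable (R : realType).
Implicit Types (x y : nat * nat -> bool).

Definition code_point x : R * R := sval (cid (address_point R x)).

Lemma code_point_attractor x : attractor (code_point x).
Proof. exact: (svalP (cid (address_point R x))).1. Qed.

Lemma code_point_near x k :
  `|coordinate (code_point x) k - (address x k)%:R| <= scale R k.
Proof. exact: (svalP (cid (address_point R x))).2. Qed.

(** Addresses have depth 0 and [depth k] is 1-Lipschitz, so [i] is at distance at least 2 from the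
    address, while the coordinate is within 1 of it. *)
Lemma code_point_between x k i : (1 < depth k i)%N ->
  ((i%:R : R) < coordinate (code_point x) k) = (i < address x k)%N.
Proof.
move=> hi.
have near := le_trans (code_point_near x k) (scale_le1 R k).
rewrite ler_norml in near.
have far : (i.+1 < address x k \/ (address x k).+1 < i)%N.
  by have := depth_lip k i (address x k); rewrite depth_address; lia.
case: far => far; have := far; rewrite -(ltr_nat R) -natr1 => farR.
  by have -> : (i < address x k)%N by [lia]; apply/idP; lra.
by have -> : (i < address x k)%N = false by [lia]; apply/negbTE; rewrite -leNgt; lra.
Qed.

Lemma same_thread_code x y : same_thread (code_point x) (code_point y) <->
  exists m, forall k, same_box (depth k) m (address x k) (address y k).
Proof.
split=> -[m hm].
  exists m.+1 => k i hi; rewrite leqNgt; apply/negP => mi.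
  have i0 : i <> address x k by move=> e; rewrite e depth_address in mi.
  have i1 : i <> address y k by move=> e; rewrite e depth_address in mi.
  have := hm k i; rewrite !code_point_between; [|lia..].
  by move=> /(_ (ltnW mi)); lia.
exists m.+1 => k i mi; rewrite !code_point_between; [|lia..].
by apply/idP/idP => h; rewrite ltnNge; apply/negP => h';
  have := hm k i; lia.
Qed.

(** Each step back along the recurrence at most doubles the error, as [walk_map] is 1-Lipschitz and
    the coupling is at most 1. *)
Lemma coordinate_contract (N : nat) (d : R) (p q : R * R) :
  `|coordinate p N - coordinate q N| <= d ->
  `|coordinate p N.+1 - coordinate q N.+1| <= d ->
  `|p.1 - q.1| <= 2 ^+ N * d /\ `|p.2 - q.2| <= 2 ^+ N * d.
Proof.
elim: N d => [|N IH] d h1 h2; first by rewrite expr0 mul1r.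
have d0 : 0 <= d by exact: le_trans h1.
rewrite exprSr -mulrA; apply: IH; last by lra.
rewrite (coordinate_rec p) (coordinate_rec q) opprD addrACA -mulrBr.
apply: le_trans (ler_normD _ _) _.
have l1 : `|walk_map N (coordinate p N.+1) - walk_map N (coordinate q N.+1)| <= d.
  exact: le_trans (walk_ext_lip _ _ _) h1.
have l2 : `|coupling R N * (coordinate p N.+2 - coordinate q N.+2)| <= d.
  rewrite normrM gtr0_norm ?coupling_gt0 //.
  by have := coupling_le1 R N; have := coupling_gt0 R N; nra.
by lra.
Qed.

(** Equal addresses put the coordinates within [2 * 4^-N] of each other, which outweighs the factor
    [2^N] of going back to stage 0. This gives the continuity of [code]. *)
Lemma code_point_lip x y (N : nat) :
  (forall j, (j <= N)%N -> x (bit_index j) = y (bit_index j)) ->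
  `|(code_point x).1 - (code_point y).1| <= 2 * 2^-1 ^+ N /\
  `|(code_point x).2 - (code_point y).2| <= 2 * 2^-1 ^+ N.
Proof.
move=> xy.
have h k : (k <= N.+1)%N ->
    `|coordinate (code_point x) k - coordinate (code_point y) k| <= 2 * scale R k.
  move=> kN; have := code_point_near x k; have := code_point_near y k.
  have -> : address x k = address y k.
    by apply: eq_address => j jk; apply: xy; lia.
  by rewrite !ler_norml; lra.
have e : 2 * 2^-1 ^+ N = 2 ^+ N * (2 * scale R N) :> R.
  rewrite /scale mulrCA -exprMn; congr (_ * _ ^+ _).
  by apply: (mulfI (_ : 2 != 0 :> R)) => //; rewrite !mulrA !divff //; lra.
rewrite e; apply: coordinate_contract; first by apply: h; lia.
by have := h N.+1 (leqnn _); have := scaleS R N; have := scale_gt0 R N.+1; lra.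
Qed.

End Addresses.

Lemma half_pow_le (R : realType) (e : R) : 0 < e ->
  exists N : nat, 2 * 2^-1 ^+ N <= e.
Proof.
move=> e0; exists (Num.truncn (2 / e)).+1; set N := (Num.truncn _).+1.
have /andP[_] : (Num.truncn (2 / e))%:R <= 2 / e < N%:R.
  by apply: truncn_itv; rewrite divr_ge0 // ltW.
have : N%:R <= 2 ^+ N :> R by rewrite -natrX ler_nat ltnW // ltn_expl.
rewrite exprVn ler_pdivrMr ?exprn_gt0 // ltr_pdivrMr //.
by move=> h1 h2; apply: le_trans (ltW h2) _; rewrite mulrC ler_pM2l.
Qed.

(** * A countable base for bit arrays *)

Section Cylinders.

(** Bits are listed by [bit_index], which may repeat some of them, so a cylinder can be empty. *)
Definition cylinder (s : seq bool) : set {ptws (nat * nat)%type -> bool} :=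
  [set x | forall j, (j < size s)%N -> x (bit_index j) = nth false s j].

Definition bit_prefix (x : nat * nat -> bool) (N : nat) : seq bool :=
  mkseq (x \o bit_index) N.

Lemma cylinder_bit_prefix x y N :
  cylinder (bit_prefix x N) y <->
  forall j, (j < N)%N -> y (bit_index j) = x (bit_index j).
Proof.
rewrite /cylinder /= size_mkseq; split => h j jN; rewrite h // nth_mkseq //.
Qed.

Lemma bit_open (ij : nat * nat) (b : bool) :
  open [set x : {ptws (nat * nat)%type -> bool} | x ij = b].
Proof.
have /continuousP : continuous (fun x : {ptws (nat * nat)%type -> bool} => x ij).
  exact: (@proj_continuous _ (fun _ : (nat * nat)%type => bool) ij).
by move=> /(_ [set b]); apply; exact: discrete_open.
Qed.

Lemma cylinder_nbhs (x : {ptws (nat * nat)%type -> bool}) N :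
  nbhs x (cylinder (bit_prefix x N)).
Proof.
elim: N => [|N IH].
  by apply: filterS filterT => y _; apply/cylinder_bit_prefix.
have : nbhs x [set y : {ptws (nat * nat)%type -> bool} |
    y (bit_index N) = x (bit_index N)].
  by apply: open_nbhs_nbhs; split; [exact: bit_open|].
move=> /(filterI IH); apply: filterS => y [/cylinder_bit_prefix h1 h2].
apply/cylinder_bit_prefix => j; rewrite ltnS leq_eqVlt => /predU1P[->//|]; exact: h1.
Qed.

(** Otherwise points outside [U], chosen in longer and longer cylinders, would converge pointwise to
    [x]. *)
Lemma open_cylinder (U : set {ptws (nat * nat)%type -> bool}) x :
  open U -> U x -> exists N, cylinder (bit_prefix x N) `<=` U.
Proof.
move=> oU Ux; apply: contrapT => /forallNP h.
have {}h N : exists y, cylinder (bit_prefix x N) y /\ ~ U y.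
  have := h N; apply: contra_notP => /forallNP h' y cy.
  by apply: contrapT => nUy; apply: (h' y).
pose g N : {ptws (nat * nat)%type -> bool} := sval (cid (h N)).
have hg N : cylinder (bit_prefix x N) (g N) /\ ~ U (g N) by exact: (svalP (cid (h N))).
have gx : g @ \oo --> x.
  have FF : Filter (g @ \oo) by exact: fmap_filter.
  apply: (iffRL (@pointwise_cvgP (nat * nat)%type bool (g @ \oo) x FF)) => ij V /= xV.
  have [n en] := bit_index_surj ij.
  exists n.+1 => // N /= nN; have [/cylinder_bit_prefix/(_ n nN)] := hg N.
  by rewrite en => -> _; exact: nbhs_singleton xV.
have [N _ /(_ N (leqnn N))] := gx U (open_nbhs_nbhs (conj oU Ux)).
exact: (hg N).2.
Qed.

Lemma open_bigcup_cylinder (U : set {ptws (nat * nat)%type -> bool}) :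
  open U -> U = \bigcup_(s in [set s | cylinder s `<=` U]) cylinder s.
Proof.
move=> oU; apply/seteqP; split => [x Ux|x [s sU /sU//]].
have [N hN] := open_cylinder oU Ux.
by exists (bit_prefix x N) => //; apply/cylinder_bit_prefix.
Qed.

End Cylinders.

(** * Borel sets and Borel maps *)

Section Borel.
Variables (T : topologicalType).
Implicit Types (A B : set T).

Lemma borel_open A : open A -> borel A.
Proof. by move=> oA; exact: sub_sigma_algebra. Qed.

Lemma borel_setC A : borel A -> borel (~` A).
Proof. by move=> bA; rewrite -setTD; exact: sigma_algebraCD. Qed.

Lemma borel_bigcup (F : nat -> set T) : (forall n, borel (F n)) ->
  borel (\bigcup_n F n).
Proof. exact: sigma_algebra_bigcup. Qed.

Lemma borel_set0 : borel (set0 : set T).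
Proof. exact: sigma_algebra0. Qed.

Lemma borel_bigcup_countable (I : countType) (D : set I) (F : I -> set T) :
  (forall i, D i -> borel (F i)) -> borel (\bigcup_(i in D) F i).
Proof.
move=> hF.
have -> : \bigcup_(i in D) F i = \bigcup_n
    (if unpickle n is Some i then if `[< D i >] then F i else set0 else set0).
  apply/seteqP; split => [x [i Di Fx]|x [n _]].
    by exists (pickle i) => //; rewrite pickleK; case: asboolP.
  by case: unpickle => // i; case: asboolP => // Di Fx; exists i.
apply: borel_bigcup => n; case: unpickle => [i|]; last exact: borel_set0.
by case: asboolP => [/hF//|_]; exact: borel_set0.
Qed.

Lemma borel_fun_open (U : topologicalType) (f : T -> U) :
  (forall B : set U, open B -> borel (f @^-1` B)) -> borel_fun f.
Proof.
move=> h B bB; apply: (bB [set B | borel (f @^-1` B)]); split=> //; split=> /=.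
- by rewrite preimage_set0; exact: borel_set0.
- by move=> A bA; rewrite setTD; exact: borel_setC.
- by move=> F bF; rewrite preimage_bigcup; exact: borel_bigcup.
Qed.

(** Open sets are countable unions of cylinders, and a cylinder restricts only finitely many
    bits. *)
Lemma borel_fun_bits (f : T -> {ptws (nat * nat)%type -> bool}) :
  (forall ij, borel [set t | f t ij]) -> borel_fun f.
Proof.
move=> h; apply: borel_fun_open => U /open_bigcup_cylinder ->.
rewrite preimage_bigcup; apply: borel_bigcup_countable => s _.
have hb ij b : borel [set t | f t ij = b].
  case: b; first exact: h.
  have -> : [set t | f t ij = false] = ~` [set t | f t ij].
    by apply/seteqP; split => t /=; [move=> ->|move/negP/negbTE].
  by apply: borel_setC; exact: h.
have -> : f @^-1` cylinder s = ~` \bigcup_(j in [set j | (j < size s)%N])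
    [set t | f t (bit_index j) = ~~ nth false s j].
  apply/seteqP; split => t /=.
    by move=> ht [j /= js]; rewrite (ht j js); case: nth.
  move=> ht j js; apply: contrapT => hj; apply: ht; exists j => //=.
  by move: hj; case: (f t _); case: (nth _ _ _) => // hj; case: hj.
by apply: borel_setC; apply: borel_bigcup_countable => j _; exact: hb.
Qed.

End Borel.

(** * The two reductions *)

Section Reductions.
Variable (R : realType).
Let X : topologicalType := set_type (@attractor R).

Lemma continuum_connected_same_thread (p q : X) :
  continuum_connected R p q <-> same_thread (set_val p) (set_val q).
Proof.
split.
  move=> /continuum_connectedP[D [DX cD kD Dp Dq]].
  exact: same_thread_sub_connected DX cD kD Dp Dq.
move=> h; apply/continuum_connectedP; apply: same_thread_connected h.
  exact: set_valP.
exact: set_valP.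
Qed.

Definition code (x : {ptws (nat * nat)%type -> bool}) : X :=
  exist _ (code_point R x) (mem_set (@code_point_attractor R x)).

Lemma code_continuous : continuous code.
Proof.
apply: (@continuous_comp_initial _ _ _ set_val).
have -> : set_val \o code = fun x => ((code_point R x).1, (code_point R x).2).
  by apply/funext => x; exact: surjective_pairing.
apply: pair_continuous => x.
all: apply/cvgrPdist_le => e e0.
all: have [N hN] := half_pow_le e0.
all: apply: (filterS _ (cylinder_nbhs x N.+1)) => y /cylinder_bit_prefix h.
all: have [h1 h2] := @code_point_lip R x y N (fun j jN => esym (h j jN)).
all: exact: le_trans hN.
Qed.

Lemma E1_reducible : borel_reducible E1 (@continuum_connected R X).
Proof.
exists code.
  apply: borel_fun_open => B oB; apply: borel_open.
  by have /continuousP := code_continuous; apply.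
move=> x y; apply: iff_trans (iff_sym (continuum_connected_same_thread _ _)).
apply: iff_trans (iff_sym (same_thread_code R x y)); exact: E1_address.
Qed.

(** Column [j] stands for a pair [(k, i)], and row [n] masks the pairs of depth at most [n]; hence
    agreement in row [m] passes to all later rows. *)
Definition thread_code (p : X) : {ptws (nat * nat)%type -> bool} := fun nj =>
  let ki := bit_index nj.2 in
  (nj.1 < depth ki.1 ki.2)%N && (ki.2%:R < coordinate (set_val p) ki.1).

Lemma thread_codeP (p q : X) :
  same_thread (set_val p) (set_val q) <-> E1 (thread_code p) (thread_code q).
Proof.
split=> -[m hm]; exists m.
  move=> n mn k; rewrite /thread_code /=; case: ltnP => //= h.
  by apply: hm; lia.
move=> k i mi; have [j ej] := bit_index_surj (k, i).
by have := hm m (leqnn m) j; rewrite /thread_code /= ej /= mi.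
Qed.

Lemma thread_code_borel : borel_fun thread_code.
Proof.
apply: borel_fun_bits => -[n j]; rewrite /thread_code /=.
case: (bit_index j) => k i /=; case: ltnP => _ /=.
  apply: borel_open.
  have c : continuous (fun p : X => coordinate (set_val p : R * R) k).
    move=> p; apply: (@continuous_comp _ _ _ set_val (fun p : R * R => coordinate p k)).
      exact: initial_continuous.
    exact: coordinate_continuous.
  by move/continuousP: c => /(_ [set x | i%:R < x]); apply; exact: open_gt.
have -> : [set t : X | false] = set0 by apply/seteqP; split.
exact: borel_set0.
Qed.

End Reductions.

(* Local compactness is that of the subspace [set_type X]: the library's
   [locally_compact X] refers to compact sets of the ambient plane and holds
   for every [X]. *)
Theorem mainTheorem5 (R : realType) :
  exists X : set (R * R)%type,
    locally_compact [set: set_type X] /\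
    borel_bireducible (@continuum_connected R (set_type X)) E1.
Proof.
exists (@attractor R); split.
  by apply: closed_locally_compact; exact: attractor_closed.
split; last exact: E1_reducible.
exists (@thread_code R); first exact: thread_code_borel.
move=> p q; apply: iff_trans (continuum_connected_same_thread p q) _.
exact: thread_codeP.
Qed.
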